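(* Let $P$ be a Markov transition matrix on a state space $\mathcal{X}$ of size $N$, with $\beta_\star<1$. Then for every $0<\varepsilon<1$, \[ t_{\mathrm{mix}}(\varepsilon) \leq 2N\,t_{\mathrm{rel}}\log t_{\mathrm{rel}} + 4(1+\log 2)N\,t_{\mathrm{rel}} + 2(\log\varepsilon^{-1} - 1)\,t_{\mathrm{rel}}. \]
   Context: $P$ is the (row-stochastic) transition matrix of a discrete time Markov chain on a finite state space $\mathcal{X}$ with $N$ elements. No reversibility or irreducibility is assumed. The complex eigenvalues of $P$, counted with algebraic multiplicity, are $\beta_1,\ldots,\beta_N$ with $\beta_N=1$, and $\beta_\star=\max\{|\beta_j| : 1\leq j\leq N-1\}$ (with $\beta_\star=0$ if $N=1$). The chain converges to a unique stationary distribution $\pi$ if and only if $\beta_\star<1$. The relaxation time is $t_{\mathrm{rel}}=1/(1-\beta_\star)$. For $0<\varepsilon<1$, the total variation mixing time is \[ t_{\mathrm{mix}}(\varepsilon)=\min\{t\geq 0 \text{ integer} : \|P^t(x,\cdot)-\pi\|_{\mathrm{TV}}\leq\varepsilon \text{ for all } x\in\mathcal{X}\}, \] where for probability measures $\mu,\nu$ on $\mathcal{X}$, $\|\mu-\nu\|_{\mathrm{TV}}=\sup_{S\subseteq\mathcal{X}}|\mu(S)-\nu(S)|=\frac12\sum_{x\in\mathcal{X}}|\mu(x)-\nu(x)|$. Here $\log$ is the natural logarithm. *)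

(* Defs.v *)
From HB Require Import structures.
From mathcomp Require Import all_boot all_order all_algebra.
From mathcomp Require Import boolp reals constructive_ereal exp.
From mathcomp Require Import complex.

Set Implicit Arguments.
Unset Strict Implicit.
Unset Printing Implicit Defensive.

Import Order.TTheory GRing.Theory Num.Theory.

Local Open Scope ring_scope.
Local Open Scope complex_scope.

Definition is_distr (R : realType) (X : finType) (mu : X -> R) : Prop :=
  (forall x, 0 <= mu x) /\ \sum_x mu x = 1.

Definition stochastic (R : realType) (X : finType) (P : X -> X -> R) : Prop :=
  forall x, is_distr (P x).

Definition stationary (R : realType) (X : finType) (P : X -> X -> R)
    (pi : X -> R) : Prop :=
  is_distr pi /\ forall y, \sum_x pi x * P x y = pi y.

Definition trans_mx (R : realType) (X : finType) (P : X -> X -> R) :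
    'M[R]_#|X| :=
  \matrix_(i, j) P (enum_val i) (enum_val j).

Definition trans_pow (R : realType) (X : finType) (P : X -> X -> R) (t : nat)
    (x y : X) : R :=
  (trans_mx P ^+ t) (enum_rank x) (enum_rank y).

(* The multiset of complex eigenvalues with algebraic multiplicity, listed in
   an unspecified order; see [char_poly_eigenvalues]. *)
Definition eigenvalues (R : realType) (X : finType) (P : X -> X -> R) :
    seq R[i] :=
  sval (closed_field_poly_normal
          (char_poly (map_mx (real_complex R) (trans_mx P)))).

Lemma char_poly_eigenvalues (R : realType) (X : finType) (P : X -> X -> R) :
  char_poly (map_mx (real_complex R) (trans_mx P)) =
    \prod_(b <- eigenvalues P) ('X - b%:P).
Proof.
rewrite /eigenvalues; case: closed_field_poly_normal => s /= Ds.
by rewrite {1}Ds (monicP (char_poly_monic _)) scale1r.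
Qed.

Lemma size_eigenvalues (R : realType) (X : finType) (P : X -> X -> R) :
  size (eigenvalues P) = #|X|.
Proof.
apply: succn_inj.
by rewrite -(size_prod_XsubC _ id) -char_poly_eigenvalues size_char_poly.
Qed.

Lemma one_eigenvalue (R : realType) (X : finType) (P : X -> X -> R) (x : X) :
  stochastic P -> 1 \in eigenvalues P.
Proof.
move=> sP; rewrite -root_prod_XsubC -char_poly_eigenvalues.
set A := map_mx _ _.
have tr_char : char_poly A^T = char_poly A.
  rewrite /char_poly -[RHS]det_tr; congr (\det _).
  by apply/matrixP => i j; rewrite !mxE eq_sym.
rewrite -tr_char -eigenvalue_root_char; apply/eigenvalueP.
exists (const_mx 1).
  rewrite scale1r -[const_mx 1 *m _]trmxK trmx_mul trmxK; apply/matrixP => i j.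
  rewrite !mxE.
  under eq_bigr do rewrite !mxE mulr1.
  rewrite -rmorph_sum /= -(rmorph1 (real_complex R)); congr (_ %:C).
  rewrite -[RHS](sP (enum_val j)).2 (reindex_onto (@enum_val X predT) enum_rank) /=.
    by apply: eq_bigl => k; rewrite enum_valK eqxx.
  by move=> k _; rewrite enum_rankK.
apply/eqP => /matrixP/(_ ord0 (enum_rank x))/eqP.
by rewrite !mxE oner_eq0.
Qed.

(* [rem 1] deletes a single occurrence of the eigenvalue 1. *)
Definition beta_star (R : realType) (X : finType) (P : X -> X -> R) : R :=
  \big[Num.max/0]_(b <- rem 1 (eigenvalues P)) Normc.normc b.

Definition t_rel (R : realType) (X : finType) (P : X -> X -> R) : R :=
  1 / (1 - beta_star P).

Definition tv_dist (R : realType) (X : finType) (mu nu : X -> R) : R :=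
  \big[Num.max/0]_(S : {set X})
    `| \sum_(x in S) mu x - \sum_(x in S) nu x |.

Definition mixed (R : realType) (X : finType) (P : X -> X -> R) (pi : X -> R)
    (eps : R) (t : nat) : bool :=
  [forall x, tv_dist (trans_pow P t x) pi <= eps].

(* Extended-real valued so that the minimum of the empty set is +oo rather
   than a spurious finite value. *)
Definition t_mix (R : realType) (X : finType) (P : X -> X -> R) (pi : X -> R)
    (eps : R) : \bar R :=
  match pselect (exists t, mixed P pi eps t) with
  | left h => (ex_minn h)%:R%:E
  | right _ => +oo%E
  end.

(* Main.v *)
Require Import Defs.
From HB Require Import structures.
From mathcomp Require Import all_boot all_order all_algebra.
From mathcomp Require Import boolp reals constructive_ereal sequences exp.
From mathcomp Require Import complex.
From mathcomp Require Import ring lra.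

(** Let [b_1, ..., b_(N-1)] be the eigenvalues of [P] other than one copy of 1,
    let [beta] be the largest of their moduli and [T = 1 / (1 - beta)].

    Row vectors of zero sum form a [P]-invariant space of dimension [N - 1]; by
    deflation the characteristic polynomial of [P] on it is the product of the
    [X - b_j], so by Cayley-Hamilton every zero-sum [v] satisfies
    [v (P - b_1) ... (P - b_(N-1)) = 0] ([shift_prod_sum0]).

    Right multiplication by [P] does not increase the l1-norm, and
    [v P^(t+1) = b_1 v P^t + (v (P - b_1)) P^t], where [v (P - b_1)] has norm at
    most [2 |v|] and is annihilated by one factor fewer. Whenever
    [K >= 1] and [beta + 2 / K <= rho], induction on [t] gives
    [|v P^t| <= K^(N-1) rho^t |v|] ([l1norm_shift_prod_pow]).

    Apply this with [v = delta_x - pi], [rho = 1 - 1 / (2 T)] (the midpoint of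
    [beta] and 1) and [K = 2 / (rho - beta) = 4 T]: the distance to stationarity
    at time [t] is at most [2 (4 T)^(N-1) rho^t <= (4 T)^N exp (- t / (2 T))],
    which is at most [eps] as soon as [t >= 2 T (N ln (4 T) + ln (1 / eps))].
    The stated bound exceeds this threshold by [(4 N - 2) T >= 1], which leaves
    room for rounding up to an integer. *)

Set Implicit Arguments.
Unset Strict Implicit.
Unset Printing Implicit Defensive.

Import Order.TTheory GRing.Theory Num.Theory.

Local Open Scope ring_scope.

(** * Products of shifted matrices acting on row vectors *)

(** The row vector [v (A - b_1) ... (A - b_k)] for [s = [:: b_1; ...; b_k]].
    Written as an iteration, it makes sense for matrices of any size, including
    size 0, and peels off one factor at a time. *)
Definition shift_prod (C : comNzRingType) (n : nat) (A : 'M[C]_n) (s : seq C)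
    (v : 'rV[C]_n) : 'rV[C]_n :=
  foldl (fun w b => w *m (A - b%:M)) v s.

Lemma shift_prod_horner (C : comNzRingType) (n : nat) (A : 'M[C]_n.+1)
    (s : seq C) (v : 'rV[C]_n.+1) :
  shift_prod A s v = v *m horner_mx A (\prod_(b <- s) ('X - b%:P)).
Proof.
elim: s v => [|b s IHs] v; first by rewrite big_nil rmorph1 mulmx1.
rewrite big_cons rmorphM rmorphB /= horner_mx_X horner_mx_C mulmxA.
exact: IHs.
Qed.

Lemma shift_prod_char_poly (C : comNzRingType) (n : nat) (A : 'M[C]_n)
    (s : seq C) (v : 'rV[C]_n) :
  char_poly A = \prod_(b <- s) ('X - b%:P) -> shift_prod A s v = 0.
Proof.
case: n A v => [|n] A v chA; first by rewrite !thinmx0.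
by rewrite shift_prod_horner -chA Cayley_Hamilton mulmx0.
Qed.

(** * Deflation of a matrix with constant row sums *)

(** If the rows of [A] sum to 1, zero-sum row vectors form an invariant space,
    on which the coordinates of positive index are free; [deflate A] is the
    matrix of [A] on that space in those coordinates. *)
Definition deflate (C : comNzRingType) (n : nat) (A : 'M[C]_(1 + n)) :
    'M[C]_n :=
  drsubmx A - const_mx 1 *m ursubmx A.

Lemma fixed_const_blocks (C : comNzRingType) (n : nat) (A : 'M[C]_(1 + n)) :
  A *m const_mx 1 = const_mx 1 :> 'cV_(1 + n) ->
  (ulsubmx A + ursubmx A *m const_mx 1 = 1%:M) *
  (dlsubmx A + drsubmx A *m const_mx 1 = const_mx 1 :> 'cV_n).
Proof.
rewrite -{1}(submxK A) -col_mx_const mul_block_col.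
have E1 : (const_mx 1 : 'M[C]_1) = 1%:M.
  by apply/matrixP => i j; rewrite !ord1 !mxE eqxx.
by case/eq_col_mx; rewrite E1 !mulmx1 => -> ->.
Qed.

(** Conjugating by the unipotent [S] whose first column is constantly 1 puts
    [A] in block upper triangular form, with diagonal blocks 1 and
    [deflate A]. *)
Lemma char_poly_deflate (C : comNzRingType) (n : nat) (A : 'M[C]_(1 + n)) :
  A *m const_mx 1 = const_mx 1 :> 'cV_(1 + n) ->
  char_poly A = ('X - 1) * char_poly (deflate A).
Proof.
move=> A1; have [row0 rows] := fixed_const_blocks A1.
pose S : 'M[{poly C}]_(1 + n) := block_mx 1%:M 0 (const_mx 1) 1%:M.
have detS : \det S = 1 by rewrite det_lblock !det1 mulr1.
pose f a b (M : 'M[C]_(a, b)) := map_mx (@polyC C) M.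
have f1 a b : const_mx 1 = f a b (const_mx 1) by rewrite /f map_const_mx.
have cE : char_poly_mx A = block_mx ('X%:M - f _ _ (ulsubmx A))
   (- f _ _ (ursubmx A)) (- f _ _ (dlsubmx A)) ('X%:M - f _ _ (drsubmx A)).
  rewrite /char_poly_mx -{1}(submxK A) map_block_mx scalar_mx_block.
  by rewrite opp_block_mx add_block_mx !add0r.
have E0 : f _ _ (ulsubmx A) + f _ _ (ursubmx A) *m const_mx 1 = 1%:M.
  by rewrite f1 /f -map_mxM -map_mxD row0 map_scalar_mx.
have E1 : f _ _ (dlsubmx A) + f _ _ (drsubmx A) *m const_mx 1
          = const_mx 1 :> 'cV_n.
  by rewrite !f1 /f -map_mxM -map_mxD rows.
have conj : char_poly_mx A *m S = S *m
    block_mx ('X - 1)%:M (- f _ _ (ursubmx A)) 0 (char_poly_mx (deflate A)).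
  rewrite cE !mulmx_block !(mul1mx, mulmx1, mul0mx, mulmx0, addr0, add0r).
  congr block_mx.
  - by rewrite mulNmx -addrA -opprD E0 raddfB.
  - rewrite mulmxBl addrCA -opprD E1 mul_scalar_mx mul_mx_scalar.
    by rewrite scalerBl scale1r.
  - rewrite /char_poly_mx /deflate map_mxB map_mxM map_const_mx -/(f _ _ _).
    by rewrite mulmxN opprB addrCA addKr.
rewrite /char_poly -[LHS]mulr1 -detS -det_mulmx conj det_mulmx detS mul1r.
by rewrite det_ublock det_scalar1.
Qed.

Lemma mulmx_const1_split (C : pzSemiRingType) (n : nat) (v : 'rV[C]_(1 + n)) :
  v *m const_mx 1 = lsubmx v + rsubmx v *m const_mx 1.
Proof.
rewrite -{1}(hsubmxK v) -(col_mx_const 1 n) mul_row_col; congr (_ + _).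
by apply/matrixP => i j; rewrite !mxE big_ord1 !mxE mulr1 !ord1.
Qed.

(** On zero-sum vectors, [A] acts as [deflate A] on the coordinates of positive
    index. *)
Lemma mulmx_deflate (C : comNzRingType) (n : nat) (A : 'M[C]_(1 + n))
    (v : 'rV[C]_(1 + n)) :
  v *m const_mx 1 = 0 :> 'M_1 ->
  rsubmx (v *m A) = rsubmx v *m deflate A.
Proof.
move=> v1; have v0 : lsubmx v = - (rsubmx v *m const_mx 1).
  by apply/eqP; rewrite -addr_eq0 -mulmx_const1_split v1.
rewrite -{1}(hsubmxK v) -{1}(submxK A) mul_row_block row_mxKr v0.
by rewrite mulmxBr mulNmx mulmxA addrC.
Qed.

Lemma deflate_shift (C : comNzRingType) (n : nat) (A : 'M[C]_(1 + n)) (b : C) :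
  deflate (A - b%:M) = deflate A - b%:M.
Proof.
rewrite /deflate -[b%:M in LHS]/(b%:M : 'M_(1 + n)) scalar_mx_block.
rewrite -{1 2}(submxK A) opp_block_mx add_block_mx block_mxKdr block_mxKur.
by rewrite subr0 addrAC.
Qed.

(** Cayley-Hamilton on the zero-sum space: the eigenvalue 1 attached to the
    constant column vector can be dropped. *)
Lemma shift_prod_sum0_block (C : idomainType) (n : nat) (A : 'M[C]_(1 + n))
    (s : seq C) (v : 'rV[C]_(1 + n)) :
  A *m const_mx 1 = const_mx 1 :> 'cV_(1 + n) ->
  char_poly A = ('X - 1) * \prod_(b <- s) ('X - b%:P) ->
  v *m const_mx 1 = 0 :> 'M_1 ->
  shift_prod A s v = 0.
Proof.
move=> A1 chA v1.
have chQ : char_poly (deflate A) = \prod_(b <- s) ('X - b%:P).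
  have X1 : 'X - 1 != 0 :> {poly C} by rewrite polyXsubC_eq0.
  by apply: (mulfI X1); rewrite -char_poly_deflate.
have {chA} key : shift_prod A s v *m const_mx 1 = 0 :> 'M_1 /\
    rsubmx (shift_prod A s v) = shift_prod (deflate A) s (rsubmx v).
  elim: s v v1 {chA chQ} => [|b s IHs] v v1 //=.
  rewrite -deflate_shift -mulmx_deflate //; apply: IHs.
  rewrite -mulmxA mulmxBl A1 mul_scalar_mx mulmxBr v1 -scalemxAr v1.
  by rewrite scaler0 subrr.
case: key; rewrite (shift_prod_char_poly _ chQ) => w1 w0.
have wl : lsubmx (shift_prod A s v) = 0.
  by rewrite -[RHS]w1 mulmx_const1_split w0 mul0mx addr0.
by rewrite -(hsubmxK (shift_prod A s v)) wl w0 row_mx0.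
Qed.

Lemma shift_prod_sum0 (C : idomainType) (n : nat) (A : 'M[C]_n) (s : seq C)
    (v : 'rV[C]_n) :
  A *m const_mx 1 = const_mx 1 :> 'cV_n ->
  char_poly A = ('X - 1) * \prod_(b <- s) ('X - b%:P) ->
  v *m const_mx 1 = 0 :> 'M_1 ->
  shift_prod A s v = 0.
Proof.
case: n A v => [|n] A v; first by rewrite !thinmx0.
exact: (@shift_prod_sum0_block C n).
Qed.

(** * Geometric decay in the l1-norm *)

(** The l1-norm, with values in [C] itself: over the complex numbers it is a
    complex number with zero imaginary part. *)
Definition l1norm (C : numDomainType) (n : nat) (v : 'rV[C]_n) : C :=
  \sum_j `|v 0 j|.

Lemma l1norm0 (C : numDomainType) (n : nat) : l1norm (0 : 'rV[C]_n) = 0.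
Proof. by apply: big1 => j _; rewrite mxE normr0. Qed.

Lemma l1norm_ge0 (C : numDomainType) (n : nat) (v : 'rV[C]_n) : 0 <= l1norm v.
Proof. exact: sumr_ge0. Qed.

Lemma ler_l1normD (C : numDomainType) (n : nat) (u v : 'rV[C]_n) :
  l1norm (u + v) <= l1norm u + l1norm v.
Proof.
by rewrite -big_split; apply: ler_sum => j _; rewrite mxE ler_normD.
Qed.

Lemma l1normZ (C : numDomainType) (n : nat) (a : C) (v : 'rV[C]_n) :
  l1norm (a *: v) = `|a| * l1norm v.
Proof. by rewrite mulr_sumr; apply: eq_bigr => j _; rewrite mxE normrM. Qed.

Lemma l1norm_stochastic (C : numDomainType) (n : nat) (A : 'M[C]_n)
    (v : 'rV[C]_n) :
  (forall i j, 0 <= A i j) -> A *m const_mx 1 = const_mx 1 :> 'cV_n ->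
  l1norm (v *m A) <= l1norm v.
Proof.
move=> A0 A1; have A1i i : \sum_j A i j = 1.
  have /matrixP/(_ i 0) := A1; rewrite !mxE => <-.
  by apply: eq_bigr => j _; rewrite mxE mulr1.
apply: (@le_trans _ _ (\sum_j \sum_i `|v 0 i| * A i j)).
  apply: ler_sum => j _; rewrite mxE; apply: le_trans (ler_norm_sum _ _ _) _.
  by apply: ler_sum => i _; rewrite normrM (ger0_norm (A0 i j)).
rewrite exchange_big /=; apply: ler_sum => i _.
by rewrite -mulr_sumr A1i mulr1.
Qed.

(** Decay of [v A^t] for a contraction [A] of the l1-norm, when [v] is
    annihilated by a product of shifts of [A] by numbers of modulus at most
    [beta <= 1]. The hypothesis relating [K] and [rho] is [beta + 2 / K <= rho],
    where 2 bounds the norm of right multiplication by [A - b]. *)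
Lemma l1norm_shift_prod_pow (C : numFieldType) (n : nat) (A : 'M[C]_n)
    (s : seq C) (beta rho K : C) (t : nat) (v : 'rV[C]_n) :
  (forall w : 'rV[C]_n, l1norm (w *m A) <= l1norm w) ->
  0 <= beta <= 1 -> 0 <= rho -> 1 <= K -> beta * K + 2 <= rho * K ->
  {in s, forall b, `|b| <= beta} ->
  shift_prod A s v = 0 ->
  l1norm (v *m A ^+ t) <= K ^+ size s * rho ^+ t * l1norm v.
Proof.
move=> Acontr /andP[beta0 beta1] rho0 K1 betaK.
have K0 : 0 <= K by apply: le_trans K1.
elim: t s v => [|t IHt] s v sbeta vs.
  by rewrite expr0 mulmx1 mulr1 ler_peMl ?l1norm_ge0 // exprn_ege1.
case: s sbeta vs => [|b s] sbeta /= vs.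
  by rewrite vs mul0mx !l1norm0 mulr0.
have bb : `|b| <= beta by apply: sbeta; rewrite mem_head.
have sb : {in s, forall b, `|b| <= beta}.
  by move=> c cs; apply: sbeta; rewrite inE cs orbT.
pose u := v *m (A - b%:M).
have u2 : l1norm u <= 2 * l1norm v.
  rewrite /u mulmxBr mul_mx_scalar mulr_natl mulr2n -scaleNr.
  apply: le_trans (ler_l1normD _ _) _; apply: lerD; first exact: Acontr.
  by rewrite l1normZ normrN ler_piMl ?l1norm_ge0 // (le_trans bb).
have -> : v *m A ^+ t.+1 = b *: (v *m A ^+ t) + u *m A ^+ t.
  rewrite exprS -[A * _]/(A *m _) mulmxA /u mulmxBr mulmxBl mul_mx_scalar.
  by rewrite -scalemxAl addrC subrK.
apply: le_trans (ler_l1normD _ _) _; rewrite l1normZ.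
have IHv : l1norm (v *m A ^+ t) <= K ^+ (size s).+1 * rho ^+ t * l1norm v.
  exact: (IHt (b :: s)).
have IHu := IHt s u sb vs.
set M := K ^+ size s * rho ^+ t.
have M0 : 0 <= M * l1norm v by rewrite !mulr_ge0 ?exprn_ge0 ?l1norm_ge0.
have -> : K ^+ (size s).+1 * rho ^+ t.+1 * l1norm v = rho * K * (M * l1norm v).
  by rewrite !exprS /M; ring.
apply: le_trans (ler_wpM2r M0 betaK); rewrite mulrDl.
have -> : beta * K * (M * l1norm v)
    = beta * (K ^+ (size s).+1 * rho ^+ t * l1norm v).
  by rewrite exprS /M; ring.
apply: lerD; first by apply: ler_pM => //; exact: l1norm_ge0.
apply: le_trans IHu _; rewrite mulrCA -/M.
by apply: ler_wpM2l u2; rewrite mulr_ge0 ?exprn_ge0.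
Qed.

(** * The transition matrix and its spectrum *)

Lemma sum_enum_val (V : nmodType) (X : finType) (F : X -> V) :
  \sum_(i < #|X|) F (enum_val i) = \sum_x F x.
Proof. by rewrite -(big_enum_val F). Qed.

Lemma trans_mx_const1 (R : realType) (X : finType) (P : X -> X -> R) :
  stochastic P -> trans_mx P *m const_mx 1 = const_mx 1 :> 'cV_#|X|.
Proof.
move=> sP; apply/matrixP => i j; rewrite !mxE -[RHS](sP (enum_val i)).2.
by rewrite -[RHS]sum_enum_val; apply: eq_bigr => k _; rewrite !mxE mulr1.
Qed.

(** A function on the state space as a row vector, in the enumeration of states
    that indexes [trans_mx]. *)
Definition distr_row (R : realType) (X : finType) (mu : X -> R) : 'rV[R]_#|X| :=
  \row_j mu (enum_val j).

Lemma distr_row_stationary (R : realType) (X : finType) (P : X -> X -> R)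
    (pi : X -> R) (t : nat) :
  stationary P pi -> distr_row pi *m trans_mx P ^+ t = distr_row pi.
Proof.
move=> [_ piP]; elim: t => [|t IHt]; first by rewrite expr0 mulmx1.
rewrite exprS -[_ * _]/(_ *m _) mulmxA -[RHS]IHt; congr (_ *m _).
apply/rowP => j; rewrite !mxE -piP -[RHS]sum_enum_val.
by apply: eq_bigr => k _; rewrite !mxE.
Qed.

Lemma map_mxX (K L : pzRingType) (f : {rmorphism K -> L}) (n : nat)
    (M : 'M[K]_n) (t : nat) : map_mx f (M ^+ t) = map_mx f M ^+ t.
Proof.
elim: t => [|t IHt]; first by rewrite !expr0 map_mx1.
by rewrite !exprS -IHt -[_ * _]/(_ *m _) map_mxM.
Qed.

Lemma l1norm_map_complex (R : realType) (n : nat) (v : 'rV[R]_n) :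
  l1norm (map_mx (real_complex R) v) = real_complex R (l1norm v).
Proof.
rewrite rmorph_sum; apply: eq_bigr => j _.
by rewrite mxE /= normc_def /= expr0n addr0 sqrtr_sqr.
Qed.

Lemma beta_star_ge0 (R : realType) (X : finType) (P : X -> X -> R) :
  0 <= beta_star P.
Proof. exact: bigmax_ge_id. Qed.

Lemma normr_eigenvalue_le (R : realType) (X : finType) (P : X -> X -> R)
    (b : R[i]) :
  b \in rem 1 (eigenvalues P) -> `|b| <= real_complex R (beta_star P).
Proof.
move=> bs; rewrite (_ : `|b| = real_complex R (Normc.normc b)); last first.
  by rewrite normc_def; case: b {bs}.
by rewrite lecR /beta_star; apply: le_bigmax_seq.
Qed.

Lemma char_poly_rem1 (R : realType) (X : finType) (P : X -> X -> R) (x : X) :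
  stochastic P ->
  char_poly (map_mx (real_complex R) (trans_mx P)) =
    ('X - 1) * \prod_(b <- rem 1 (eigenvalues P)) ('X - b%:P).
Proof.
move=> sP; rewrite char_poly_eigenvalues.
by rewrite (big_rem _ (one_eigenvalue x sP)).
Qed.

(** The decay estimate for the chain itself. It is proved after extension of
    scalars to the complex numbers, where the eigenvalues live. *)
Lemma l1norm_trans_pow (R : realType) (X : finType) (P : X -> X -> R)
    (rho K : R) (t : nat) (v : 'rV[R]_#|X|) :
  stochastic P -> beta_star P <= 1 -> 0 <= rho -> 1 <= K ->
  beta_star P * K + 2 <= rho * K ->
  v *m const_mx 1 = 0 :> 'M_1 ->
  l1norm (v *m trans_mx P ^+ t) <= K ^+ #|X|.-1 * rho ^+ t * l1norm v.
Proof.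
move=> sP beta1 rho0 K1 betaK v1.
have [x _ | X0] := pickP X; last first.
  have v0 : v = 0.
    by apply/rowP => j; have := X0 (enum_val j).
  by rewrite v0 mul0mx !l1norm0 mulr0.
pose f : {rmorphism R -> R[i]} := real_complex R.
have fle a b : (f a <= f b) = (a <= b) by exact: lecR.
have fl1 n (w : 'rV[R]_n) : f (l1norm w) = l1norm (map_mx f w).
  by rewrite l1norm_map_complex.
rewrite -fle !rmorphM !rmorphXn !fl1 map_mxM map_mxX.
have f1 a b : const_mx 1 = map_mx f (const_mx 1) :> 'M_(a, b).
  by rewrite map_const_mx rmorph1.
have A1 : map_mx f (trans_mx P) *m const_mx 1 = const_mx 1 :> 'cV_#|X|.
  by rewrite !f1 -map_mxM trans_mx_const1.
have <- : size (rem 1 (eigenvalues P)) = #|X|.-1.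
  by rewrite size_rem ?size_eigenvalues // (one_eigenvalue x).
apply: (@l1norm_shift_prod_pow _ _ _ _ (f (beta_star P))).
- move=> w; apply: l1norm_stochastic => // i j.
  by rewrite !mxE ler0c; exact: (sP _).1.
- by rewrite -[0](rmorph0 f) -[1](rmorph1 f) !fle beta_star_ge0.
- by rewrite -[0](rmorph0 f) fle.
- by rewrite -[1](rmorph1 f) fle.
- by rewrite -[2](rmorph_nat f 2) -!rmorphM -rmorphD fle.
- exact: normr_eigenvalue_le.
- apply: shift_prod_sum0 => //; first exact: (char_poly_rem1 x).
  by rewrite f1 -map_mxM v1 map_mx0.
Qed.

(** * Mixing time *)

(** For [mu] and [nu] of equal mass a factor one half could be gained, but the
    stated bound is reached without it. *)
Lemma tv_dist_le_l1norm (R : realType) (X : finType) (mu nu : X -> R) :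
  tv_dist mu nu <= l1norm (distr_row mu - distr_row nu).
Proof.
have -> : l1norm (distr_row mu - distr_row nu) = \sum_x `|mu x - nu x|.
  by rewrite -[RHS]sum_enum_val; apply: eq_bigr => j _; rewrite !mxE.
apply: bigmax_le => [|S _]; first exact: sumr_ge0.
rewrite -sumrB; apply: le_trans (ler_norm_sum _ _ _) _.
by rewrite [leRHS](bigID (mem S)) /= lerDl sumr_ge0.
Qed.

Lemma tv_dist_trans_pow (R : realType) (X : finType) (P : X -> X -> R)
    (pi : X -> R) (rho K : R) (t : nat) (x : X) :
  stochastic P -> stationary P pi -> beta_star P <= 1 ->
  0 <= rho -> 1 <= K -> beta_star P * K + 2 <= rho * K ->
  tv_dist (trans_pow P t x) pi <= 2 * K ^+ #|X|.-1 * rho ^+ t.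
Proof.
move=> sP piP beta1 rho0 K1 betaK.
pose e : 'rV[R]_#|X| := delta_mx 0 (enum_rank x).
have e1 : e *m const_mx 1 = 1%:M :> 'M_1.
  apply/matrixP => i j; rewrite !ord1 !mxE (bigD1 (enum_rank x)) //= !mxE !eqxx.
  rewrite mulr1 big1 ?addr0 // => k /negPf kx.
  by rewrite !mxE kx andbF mul0r.
have [pi0 pisum] := piP.1.
have p1 : distr_row pi *m const_mx 1 = 1%:M :> 'M_1.
  apply/matrixP => i j; rewrite !ord1 !mxE -[RHS]pisum -[RHS]sum_enum_val.
  by apply: eq_bigr => k _; rewrite !mxE mulr1.
have v2 : l1norm (e - distr_row pi) <= 2.
  have l1e : l1norm e = 1.
    rewrite /l1norm (bigD1 (enum_rank x)) //= mxE !eqxx normr1 big1 ?addr0 //.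
    by move=> k /negPf kx; rewrite mxE kx andbF normr0.
  have l1p : l1norm (distr_row pi) = 1.
    rewrite -[RHS]pisum -[RHS]sum_enum_val; apply: eq_bigr => k _.
    by rewrite mxE ger0_norm.
  apply: le_trans (ler_l1normD _ _) _.
  by rewrite -scaleN1r l1normZ normrN1 mul1r l1e l1p.
apply: le_trans (tv_dist_le_l1norm _ _) _.
have -> : distr_row (trans_pow P t x) = e *m trans_mx P ^+ t.
  by rewrite -rowE; apply/rowP => j; rewrite !mxE /trans_pow enum_valK.
rewrite -{1}(distr_row_stationary t piP) -mulmxBl.
apply: le_trans (l1norm_trans_pow t sP beta1 rho0 K1 betaK _) _.
  by rewrite mulmxBl e1 p1 subrr.
rewrite -[leRHS]mulrA [leRHS]mulrC; apply: ler_wpM2l v2.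
by rewrite mulr_ge0 ?exprn_ge0 // (le_trans _ K1).
Qed.

Lemma t_mix_le (R : realType) (X : finType) (P : X -> X -> R) (pi : X -> R)
    (eps : R) (t : nat) :
  mixed P pi eps t -> (t_mix P pi eps <= t%:R%:E)%E.
Proof.
rewrite /t_mix => mt; case: pselect => [h|[]]; last by exists t.
by case: ex_minnP => m _ /(_ t mt) mlet; rewrite lee_fin ler_nat.
Qed.

Theorem theorem1p2 (R : realType) (X : finType) (P : X -> X -> R)
    (pi : X -> R) (eps : R) :
  stochastic P ->
  beta_star P < 1 ->
  stationary P pi ->
  0 < eps < 1 ->
  (t_mix P pi eps <=
     (2 * #|X|%:R * t_rel P * ln (t_rel P)
      + 4 * (1 + ln 2) * #|X|%:R * t_rel P
      + 2 * (ln eps^-1 - 1) * t_rel P)%:E)%E.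
Proof.
move=> sP beta1 piP /andP[eps0 eps1].
set T := t_rel P; set N : R := #|X|%:R.
have beta0 := beta_star_ge0 P.
have gap0 : 0 < 1 - beta_star P by rewrite subr_gt0.
have T1 : 1 <= T by rewrite /T /t_rel ler_pdivlMr // mul1r gerBl.
have T0 : 0 < T by rewrite (lt_le_trans _ T1).
have betaE : beta_star P = 1 - T^-1 by rewrite /T /t_rel div1r invrK subKr.
clearbody T.
have [X0|Xgt0] := posnP #|X|.
  have := piP.1.2; rewrite big1 => [/eqP|x _].
    by rewrite eq_sym oner_eq0.
  by have := fintype0 x X0.
have N1 : 1 <= N by rewrite ler1n.
(* The time from which the distance bound is below eps. *)
set s := 2 * T * (N * ln (4 * T) + ln eps^-1).
have ln4T : ln (4 * T) = 2 * ln 2 + ln T.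
  have -> : 4 * T = 2 * (2 * T) by ring.
  have T2 : 0 < 2 * T by rewrite mulr_gt0.
  rewrite (@lnM R 2 (2 * T)) ?posrE // (@lnM R 2 T) ?posrE //.
  by rewrite addrA mulr_natl mulr2n.
have ln2 : 0 <= ln 2 :> R by rewrite ln_ge0 ?ler1n.
have lnT : 0 <= ln T by rewrite ln_ge0.
have lneps : 0 <= ln eps^-1 by rewrite ltW // ln_gt0 // invf_gt1.
have s0 : 0 <= s.
  have ln4T0 : 0 <= ln (4 * T) by rewrite ln4T; lra.
  by rewrite /s mulr_ge0 ?addr_ge0 ?(mulr_ge0 _ ln4T0) ?(mulr_ge0 _ (ltW T0)).
set t := (Num.truncn s).+1.
have st : s <= t%:R by apply/ltW/truncnS_gt.
have ts : t%:R <= s + 1.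
  by rewrite -natr1 lerD2r; case/andP: (truncn_itv s0).
apply: (@le_trans _ _ t%:R%:E).
  apply: t_mix_le; apply/forallP => x.
  (* rho is the midpoint of beta_star P = 1 - 1 / T and 1, and
     2 / (rho - beta_star P) = 4 T. *)
  pose rho := 1 - (2 * T)^-1.
  have Ti : T * T^-1 = 1 by rewrite mulfV ?gt_eqF.
  have iT2 : (2 * T)^-1 = T^-1 / 2 by rewrite invfM mulrC.
  have Ti0 : 0 < T^-1 by rewrite invr_gt0.
  apply: le_trans (@tv_dist_trans_pow _ _ _ _ rho (4 * T) _ _ sP piP _ _ _ _) _.
  - exact: ltW.
  - by rewrite /rho iT2; nra.
  - by nra.
  - by rewrite betaE /rho iT2; nra.
  have K0 : 0 < 4 * T by rewrite mulr_gt0.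
  have rhot : rho ^+ t <= ((4 * T) ^+ #|X|)^-1 * eps.
    have -> : ((4 * T) ^+ #|X|)^-1 * eps
        = expR (- (N * ln (4 * T) + ln eps^-1)).
      rewrite expRN expRD expRM_natl !lnK ?posrE ?invr_gt0 //.
      by rewrite invfM invrK.
    apply: (@le_trans _ _ (expR (- (2 * T)^-1) ^+ t)).
      by rewrite lerXn2r ?nnegrE ?expR_ge0 ?expR_ge1Dx // /rho iT2; nra.
    rewrite -expRM_natl ler_expR mulrN lerN2 ler_pdivlMr ?mulr_gt0 //.
    by rewrite mulrC.
  have Kge0 k : 0 <= (4 * T) ^+ k by rewrite exprn_ge0 ?ltW.
  apply: le_trans (ler_wpM2l _ rhot) _; first by rewrite mulr_ge0.
  rewrite mulrA ler_piMl ?(ltW eps0) // ler_pdivrMr ?exprn_gt0 // mul1r.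
  (* The prefactor 2 is at most 4 T, which turns (4 T)^(N-1) into (4 T)^N. *)
  rewrite -[in leRHS](prednK Xgt0) exprS ler_wpM2r //.
  by lra.
(* Rounding costs 1 <= T, and the stated bound is s + (4 N - 2) T. *)
rewrite lee_fin; apply: le_trans ts _; rewrite /s ln4T.
have NT : T <= N * T by rewrite ler_peMl ?(ltW T0).
by nra.
Qed.
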